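(* Let $n\ge 2$ and $m\in\{1,2,\dots,n-1\}$. Let $M,N\subset\mathbb{S}_n$ be Nash submanifolds (of $\mathbb{R}^{2n}$) such that there exist complex tangential Nash diffeomorphisms $\Phi:(-1,1)^m\to M$ and $\Psi:(-1,1)^m\to N$. Fix $\alpha\in(0,n]$. Then $\mathrm{cap}_\alpha(M)>0$ if and only if $\mathrm{cap}_\alpha(N)>0$.
   Context: Notation: $\langle z,w\rangle=z_1\overline{w_1}+\dots+z_n\overline{w_n}$ and $\|z\|=\sqrt{\langle z,z\rangle}$ on $\mathbb{C}^n$; $\mathbb{S}_n=\{z\in\mathbb{C}^n:\|z\|=1\}$. $\mathbb{C}^n$ is identified with $\mathbb{R}^{2n}$. Semi-algebraic notions: A subset of $\mathbb{R}^N$ is semi-algebraic if it is a finite union of sets each defined by finitely many real polynomial equations $f=0$ and strict inequalities $g>0$. A map between semi-algebraic sets $A\subset\mathbb{R}^M$, $B\subset\mathbb{R}^N$ is semi-algebraic if its graph is a semi-algebraic subset of $\mathbb{R}^{M+N}$. A Nash map is a semi-algebraic map of class $C^\infty$. A Nash diffeomorphism is a bijection $f$ such that both $f$ and $f^{-1}$ are Nash. A semi-algebraic set $M\subset\mathbb{R}^N$ is a Nash submanifold of $\mathbb{R}^N$ of dimension $d$ if for every $x\in M$ there is a Nash diffeomorphism $\phi$ from an open semi-algebraic neighborhood $\Omega$ of the origin in $\mathbb{R}^N$ onto an open semi-algebraic neighborhood $\Omega'$ of $x$ in $\mathbb{R}^N$ such that $\phi(0)=x$ and $\phi((\mathbb{R}^d\times\{0\})\cap\Omega)=M\cap\Omega'$.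 Complex tangential: for $\Omega\subset\mathbb{R}^m$ open, a $C^1$ map $\Phi:\Omega\to\mathbb{S}_n$ with Jacobian $J_\Phi(x)$ at $x$ (an $n\times m$ complex matrix) is complex tangential if $\langle J_\Phi(x)\cdot h,\Phi(x)\rangle=0$ for all $x\in\Omega$ and all $h\in\mathbb{R}^m$. Riesz $\alpha$-capacity (with respect to the anisotropic distance $d(\zeta,\eta)=|1-\langle\zeta,\eta\rangle|^{1/2}$): for $\alpha\in(0,n]$ and $t>0$ put $K_\alpha(t)=t^{\alpha-n}$ if $\alpha<n$ and $K_n(t)=\log(e/t)$, with $K_\alpha(0)=+\infty$. For a Borel probability measure $\mu$ supported on a compact set $E\subset\mathbb{S}_n$, its Riesz $\alpha$-energy is $$I_\alpha[\mu]=\iint_{\mathbb{S}_n\times\mathbb{S}_n}K_\alpha(|1-\langle\zeta,\eta\rangle|)\,d\mu(\zeta)\,d\mu(\eta)\in[0,+\infty].$$ For compact $E\subset\mathbb{S}_n$, $\mathrm{cap}_\alpha(E)=\left(\inf\{I_\alpha[\mu]:\mu\in\mathcal{P}(E)\}\right)^{-1}$, where $\mathcal{P}(E)$ is the set of Borel probability measures supported on $E$ (so $\mathrm{cap}_\alpha(E)=0$ if and only if $I_\alpha[\mu]=+\infty$ for all $\mu\in\mathcal{P}(E)$). For Borel $E\subset\mathbb{S}_n$, $\mathrm{cap}_\alpha(E)=\sup\{\mathrm{cap}_\alpha(K):K\subset E,\ K\text{ compact}\}$. *)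

(* Defs.v *)
From HB Require Import structures.
From mathcomp Require Import all_boot all_order all_algebra.
From mathcomp Require Import complex.
From mathcomp Require Import all_classical all_reals all_analysis.
From mathcomp Require mpoly.

Set Implicit Arguments.
Unset Strict Implicit.
Unset Printing Implicit Defensive.

Import Order.TTheory GRing.Theory Num.Theory.
Import numFieldNormedType.Exports.

Local Open Scope classical_set_scope.
Local Open Scope ring_scope.

Section SemiAlgebraic.
Variable R : realType.

(* A basic set is given by a pair (equations, strict inequalities). *)
Definition semialgebraic (N : nat) (A : set 'rV[R]_N) : Prop :=
  exists c : seq (seq (mpoly.mpoly N R) * seq (mpoly.mpoly N R)),
    A = [set x | has (fun fg =>
           all (fun f => mpoly.meval (fun i => x 0 i) f == 0) fg.1 &&
           all (fun g => 0 < mpoly.meval (fun i => x 0 i) g) fg.2) c].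

(* A map from A to B is represented by a total function, of which only the values on
   A matter. *)
Definition semialgebraic_map (M N : nat) (A : set 'rV[R]_M) (B : set 'rV[R]_N)
    (f : 'rV[R]_M -> 'rV[R]_N) : Prop :=
  [/\ semialgebraic A, semialgebraic B, (forall x, A x -> B (f x)) &
      semialgebraic [set row_mx x (f x) | x in A]].

(* The iterated partial derivative along the coordinates listed in [s]. *)
Fixpoint partials (M N : nat) (s : seq 'I_M) (f : 'rV[R]_M -> 'rV[R]_N)
    : 'rV[R]_M -> 'rV[R]_N :=
  if s is i :: s' then fun x => 'D_(delta_mx 0 i) (partials s' f) x else f.

(* Meaningful for open [U]: the derivatives at a point of [U] then depend only
   on the values of [f] on [U]. *)
Definition class_C (r : nat) (M N : nat) (U : set 'rV[R]_M)
    (f : 'rV[R]_M -> 'rV[R]_N) : Prop :=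
  forall (s : seq 'I_M) (x : 'rV[R]_M), (size s <= r)%N -> U x ->
    {for x, continuous (partials s f)} /\
    ((size s < r)%N ->
       forall i : 'I_M, derivable (partials s f) x (delta_mx 0 i)).

(* For arbitrary [A], e.g. a submanifold, smoothness means having smooth local
   extensions to the ambient space; on an open [A] this is the usual notion. *)
Definition smooth_on (M N : nat) (A : set 'rV[R]_M)
    (f : 'rV[R]_M -> 'rV[R]_N) : Prop :=
  forall x, A x -> exists (U : set 'rV[R]_M) (g : 'rV[R]_M -> 'rV[R]_N),
    [/\ open U, U x, (forall r, class_C r U g) &
        forall y, A y -> U y -> f y = g y].

Definition nash_map (M N : nat) (A : set 'rV[R]_M) (B : set 'rV[R]_N)
    (f : 'rV[R]_M -> 'rV[R]_N) : Prop :=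
  semialgebraic_map A B f /\ smooth_on A f.

Definition nash_diffeo (M N : nat) (A : set 'rV[R]_M) (B : set 'rV[R]_N)
    (f : 'rV[R]_M -> 'rV[R]_N) : Prop :=
  exists g : 'rV[R]_N -> 'rV[R]_M,
    [/\ nash_map A B f, nash_map B A g,
        (forall x, A x -> g (f x) = x) & (forall y, B y -> f (g y) = y)].

Definition nash_submanifold_dim (N d : nat) (M : set 'rV[R]_N) : Prop :=
  [/\ (d <= N)%N, semialgebraic M & forall x, M x ->
    exists (W W' : set 'rV[R]_N) (phi : 'rV[R]_N -> 'rV[R]_N),
      [/\ open W /\ semialgebraic W, open W' /\ semialgebraic W',
          W 0 /\ W' x, nash_diffeo W W' phi /\ phi 0 = x &
          phi @` ([set y : 'rV[R]_N | forall i : 'I_N, (d <= i)%N -> y 0 i = 0] `&` W)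
          = M `&` W']].

Definition nash_submanifold (N : nat) (M : set 'rV[R]_N) : Prop :=
  exists d, nash_submanifold_dim d M.

Definition cube (m : nat) : set 'rV[R]_m :=
  [set x | forall i, -1 < x 0 i < 1].

End SemiAlgebraic.
Arguments cube R m : clear implicits.

Section Sphere.
Variable R : realType.

Definition hdot (n : nat) (z w : 'cV[R[i]]_n) : R[i] :=
  \sum_j z j 0 * (w j 0)^*.

Definition hnorm (n : nat) (z : 'cV[R[i]]_n) : R[i] := sqrtC (hdot z z).

(* The first n real coordinates are the real parts, the last n the imaginary
   parts. *)
Definition toC (n : nat) (x : 'rV[R]_(n + n)) : 'cV[R[i]]_n :=
  \col_j Complex (x 0 (lshift n j)) (x 0 (rshift n j)).

Definition sphere (n : nat) : set 'rV[R]_(n + n) :=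
  [set x | hnorm (toC x) = 1].

(* The library's ['J] acts on row vectors, so its k-th row is the k-th partial
   derivative. *)
Definition cjacobian (m n : nat) (Phi : 'rV[R]_m -> 'rV[R]_(n + n))
    (x : 'rV[R]_m) : 'M[R[i]]_(n, m) :=
  \matrix_(j, k) toC (row k ('J Phi x)) j 0.

Definition complex_tangential (m n : nat) (W : set 'rV[R]_m)
    (Phi : 'rV[R]_m -> 'rV[R]_(n + n)) : Prop :=
  [/\ open W, (forall x, W x -> sphere (Phi x)), class_C 1 W Phi &
      forall x (h : 'cV[R]_m), W x ->
        hdot (cjacobian Phi x *m map_mx (real_complex R) h) (toC (Phi x)) = 0].

End Sphere.
Arguments sphere R n : clear implicits.

Section Capacity.
Variable R : realType.
Local Open Scope ereal_scope.

Definition borelC (n : nat) := g_sigma_algebraType (@open 'rV[R]_(n + n)).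

Definition riesz_kernel (n : nat) (alpha t : R) : \bar R :=
  if t == 0%R then +oo
  else if (alpha < n%:R)%R then (t `^ (alpha - n%:R))%:E
  else (ln (expR 1 / t))%:E.

Definition riesz_energy (n : nat) (alpha : R) (mu : probability (borelC n) R)
    : \bar R :=
  \int[mu \x mu]_(p in (sphere R n `*` sphere R n : set (borelC n * borelC n)))
     riesz_kernel n alpha (Normc.normc (1 - hdot (toC p.1) (toC p.2))%R).

(* The extended inverse satisfies 0^-1 = +oo and +oo^-1 = 0, and the infimum of
   the empty set is +oo. *)
Definition cap_compact (n : nat) (alpha : R) (E : set 'rV[R]_(n + n)) : \bar R :=
  (ereal_inf [set riesz_energy alpha mu |
     mu in [set mu : probability (borelC n) R | mu (~` E) = 0]])^-1.

Definition cap (n : nat) (alpha : R) (E : set 'rV[R]_(n + n)) : \bar R :=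
  ereal_sup [set cap_compact alpha K | K in [set K | compact K /\ K `<=` E]].

End Capacity.

(* Main.v *)
Require Import Defs.
From HB Require Import structures.
From mathcomp Require Import all_boot all_order all_algebra.
From mathcomp Require Import complex.
From mathcomp Require Import all_classical all_reals all_analysis.
From mathcomp Require Import measurable_realfun.
From mathcomp Require Import ring lra.

Set Implicit Arguments.
Unset Strict Implicit.
Unset Printing Implicit Defensive.

Import Order.TTheory GRing.Theory Num.Theory.
Import numFieldNormedType.Exports.

Local Open Scope classical_set_scope.
Local Open Scope ring_scope.

(** A complex tangential chart carries the square of the anisotropic distance,
    |1 - <z, w>|, to the square of the Euclidean distance, up to constants and
    locally uniformly.  For z = Phi x and w = Phi y, put f u = <Phi u, w>.  Then
    1 - <z, w> = f y - f x, and tangency turns every partial derivative of f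
    into D f u = <D Phi u, w - Phi u>, which is O(|y - u|); integrating along
    the box between x and y gives |1 - <z, w>| = O(|x - y|^2)
    ([dotr_image_near], [tangential_gap_near]).  In the other direction
    |1 - <z, w>| is at least its real part |z - w|^2 / 2 ([gap_ge]), and
    |x - y| = O(|z - w|) on compact sets because the inverse of the chart is
    the restriction of a smooth map ([smooth_on_lipschitz]).

    Let K be a compact part of M and g the inverse of Phi.  The map F = Psi o g
    of K into N then satisfies |1 - <z, w>| <= D |1 - <F z, F w>| on K, and a
    Riesz kernel evaluated at an argument divided by D grows at most affinely
    ([riesz_kernel_scale]).  So the image under F of a probability of finite
    energy on K is a probability of finite energy on F(K)
    ([riesz_energy_transport]).  Positive capacity means that such a probability
    lives on some compact part ([cap_gt0]), and exchanging Phi and Psi gives the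
    converse.

    The tangency condition speaks of the Jacobian of the total differential,
    while smoothness is expressed by continuous partial derivatives; the two are
    related by [class_C1_differentiable]. *)

(** * Boxes and the sup norm *)
Section coordinate_norm.
Context {R : realType} {n : nat}.
Implicit Types x y z : 'rV[R]_n.

Lemma coord_le_norm x i : `|x 0 i| <= `|x|.
Proof.
rewrite [leRHS]/Num.Def.normr/= mx_normrE.
exact: (le_bigmax _ (fun ij => `|x ij.1 ij.2|) (0, i)).
Qed.

Lemma norm_le_coord x (e : R) : 0 <= e -> (forall i, `|x 0 i| <= e) -> `|x| <= e.
Proof.
move=> e0 xe; rewrite [leLHS]/Num.Def.normr/= mx_normrE.
by apply: bigmax_le => // -[i j] _ /=; rewrite ord1.
Qed.

Lemma sum_coord_le_norm x : \sum_i `|x 0 i| <= n%:R * `|x|.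
Proof.
apply: (@le_trans _ _ (\sum_(i < n) `|x|)).
  by apply: ler_sum => i _; exact: coord_le_norm.
by rewrite sumr_const card_ord mulr_natl.
Qed.

(** The region swept by paths from [x] to [y] that change one coordinate at a
    time, each monotonically.  Balls of the sup norm contain the boxes spanned by
    their points, see [box_ball]. *)
Definition box x y : set 'rV[R]_n :=
  [set z | forall i, Num.min (x 0 i) (y 0 i) <= z 0 i <= Num.max (x 0 i) (y 0 i)].

Lemma box_dist x y z : box x y z -> `|x - z| <= `|x - y|.
Proof.
move=> bz; apply: norm_le_coord => // i.
apply: le_trans (coord_le_norm _ i); rewrite !mxE.
have := bz i; have [xy|yx] := leP (x 0 i) (y 0 i) => /andP[h1 h2].
  rewrite distrC [leRHS]distrC !ger0_norm ?subr_ge0//.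
  exact: lerB.
by rewrite !ger0_norm ?subr_ge0// ?lerB// ltW.
Qed.

Lemma box_ball (a : 'rV[R]_n) r x y z : ball a r x -> ball a r y -> box x y z -> ball a r z.
Proof.
move=> [r0 ax] [_ ay] bz; split=> // i j; rewrite ord1.
have := ax 0 j; have := ay 0 j; rewrite /ball/=.
have /andP[] := bz j; rewrite !ltr_distlC => h1 h2 /andP[h3 h4] /andP[h5 h6].
apply/andP; split.
  by apply: lt_le_trans h1; rewrite lt_min h5 h3.
by apply: (le_lt_trans h2); rewrite gt_max h6 h4.
Qed.

End coordinate_norm.

(** * The mean value inequality, one coordinate at a time *)
Section mean_value.
Context {R : realType} {V : normedModType R}.

Lemma mean_value_segment (f : V -> R) (z v : V) (d e a b : R) : a <= b ->
  (forall s, a <= s <= b -> derivable f (z + s *: v) v /\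
     `|'D_v f (z + s *: v) - d| <= e) ->
  `|f (z + b *: v) - f (z + a *: v) - d * (b - a)| <= e * (b - a).
Proof.
move=> ab H; pose g s := f (z + s *: v).
have gE s : (fun h => h^-1 *: ((g \o shift s) (h *: 1) - g s)) =
            (fun h => h^-1 *: ((f \o shift (z + s *: v)) (h *: v) - f (z + s *: v))).
  apply/funext => h; rewrite /g /=; congr (_ *: (f _ - _)).
  by rewrite [h *: 1]mulr1 scalerDl addrCA.
have gd s : a <= s <= b -> is_derive s 1 g ('D_v f (z + s *: v)).
  move=> sab; have [df _] := H _ sab.
  by apply: DeriveDef; rewrite /derivable /derive gE.
have [||c] := @MVT_segment R g (fun s => 'D_v f (z + s *: v)) a b ab.
- by move=> s; rewrite in_itv /= => /andP[/ltW sa /ltW sb]; apply: gd; rewrite sa.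
- apply: derivable_within_continuous => s; rewrite in_itv /= => sab.
  by have [] := gd _ sab.
rewrite in_itv /= => cab; rewrite -/(g b) -/(g a) => ->.
rewrite -mulrBl normrM (ger0_norm (_ : 0 <= b - a)) ?subr_ge0//.
by rewrite ler_wpM2r ?subr_ge0//; have [] := H _ cab.
Qed.

End mean_value.

Section mean_value_coordinates.
Context {R : realType} {m : nat}.
Implicit Types x y z : 'rV[R]_m.

(** Replacing the coordinates of [x] by those of [y] one after the other, the
    one-variable inequality applies to each step and the errors add up.  Taking
    for [d] the partial derivatives at [x] gives differentiability; taking
    [d := 0] gives Lipschitz estimates. *)
Lemma mean_value_box (f : 'rV[R]_m -> R) x y (d : 'rV[R]_m) (e : R) :
  (forall z, box x y z -> forall i, derivable f z (delta_mx 0 i) /\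
     `|'D_(delta_mx 0 i) f z - d 0 i| <= e) ->
  `|f y - f x - \sum_i d 0 i * (y 0 i - x 0 i)| <= e * \sum_i `|y 0 i - x 0 i|.
Proof.
move=> H.
(* [w k] is the path after the first [k] coordinates have been changed. *)
pose w k : 'rV[R]_m := \row_i (if (i < k)%N then y 0 i else x 0 i).
suff W k : (k <= m)%N ->
    `|f (w k) - f x - \sum_(i < m | (i < k)%N) d 0 i * (y 0 i - x 0 i)|
    <= e * \sum_(i < m | (i < k)%N) `|y 0 i - x 0 i|.
  have := W m (leqnn m).
  have -> : w m = y by apply/rowP => i; rewrite mxE ltn_ord.
  have E (F : 'I_m -> R) : \sum_(i < m | (i < m)%N) F i = \sum_i F i.
    by apply: eq_bigl => i; rewrite ltn_ord.
  by rewrite !E.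
elim: k => [_|k IH km].
  have -> : w 0%N = x by apply/rowP => i; rewrite mxE.
  by rewrite !big_pred0// subrr subr0 normr0 mulr0.
have {}IH := IH (ltnW km).
pose o := Ordinal km.
have S (F : 'I_m -> R) :
    \sum_(i < m | (i < k.+1)%N) F i = F o + \sum_(i < m | (i < k)%N) F i.
  rewrite (bigD1 o) ?ltnS//=; congr (_ + _); apply: eq_bigl => i.
  by rewrite ltnS (leq_eqVlt i) -val_eqE /=; case: ltngtP.
rewrite !S [e * _]mulrDr.
(* Coordinate [o] is erased, so that [w k] and [w k.+1] lie on one line. *)
pose z : 'rV[R]_m := \row_i (if i == o then 0 else w k 0 i).
have zE t i : (z + t *: delta_mx 0 o) 0 i = if i == o then t else w k 0 i.
  rewrite !mxE eqxx/=; case: (eqVneq i o) => _ /=; first by rewrite mulr1 add0r.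
  by rewrite mulr0 addr0.
have wk : w k = z + x 0 o *: delta_mx 0 o.
  apply/rowP => i; rewrite zE; case: (eqVneq i o) => // ->.
  by rewrite mxE /= ltnn.
have wk1 : w k.+1 = z + y 0 o *: delta_mx 0 o.
  apply/rowP => i; rewrite zE; case: (eqVneq i o) => [->|io].
    by rewrite mxE /= ltnSn.
  rewrite !mxE ltnS leq_eqVlt; suff /negbTE -> : (i : nat) != k by [].
  by rewrite -[k]/(o : nat) val_eqE.
have bz t : Num.min (x 0 o) (y 0 o) <= t <= Num.max (x 0 o) (y 0 o) ->
    box x y (z + t *: delta_mx 0 o).
  move=> txy i; rewrite zE; case: (eqVneq i o) => [->//|_].
  by rewrite mxE; case: ifP => _; rewrite ?ge_min ?le_max lexx ?orbT.
have step : `|f (w k.+1) - f (w k) - d 0 o * (y 0 o - x 0 o)|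
    <= e * `|y 0 o - x 0 o|.
  rewrite wk wk1; have [xy|/ltW yx] := leP (x 0 o) (y 0 o).
    rewrite (ger0_norm (_ : 0 <= y 0 o - x 0 o)) ?subr_ge0//.
    apply: mean_value_segment => // s sxy; apply: H; apply: bz.
    by rewrite min_l ?max_r.
  rewrite (ler0_norm (_ : y 0 o - x 0 o <= 0)) ?subr_le0// opprB.
  have -> (A B c u v : R) : `|A - B - c * (u - v)| = `|B - A - c * (v - u)|.
    by rewrite -normrN; congr (`| _ |); ring.
  apply: mean_value_segment => // s sxy; apply: H; apply: bz.
  by rewrite min_r ?max_l.
apply: (le_trans _ (lerD step IH)).
apply: (le_trans _ (ler_normD _ _)); rewrite le_eqVlt; apply/orP; left; apply/eqP.
by congr (`| _ |); ring.
Qed.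

End mean_value_coordinates.

(** * Maps with continuous partial derivatives *)
Section class_C1.
Context {R : realType} {m n : nat}.
Implicit Types (f : 'rV[R]_m -> 'rV[R]_n) (U : set 'rV[R]_m) (x z : 'rV[R]_m).

Lemma class_C1_derivable U f z i : class_C 1 U f -> U z ->
  derivable f z (delta_mx 0 i).
Proof. by move=> fC Uz; have [_] := fC [::] z isT Uz; exact. Qed.

Lemma class_C1_continuous U f z : class_C 1 U f -> U z -> {for z, continuous f}.
Proof. by move=> fC Uz; have [] := fC [::] z isT Uz. Qed.

Lemma partials_near U f x (e : R) : open U -> class_C 1 U f -> U x -> 0 < e ->
  exists2 r, 0 < r & forall z, ball x r z ->
    U z /\ forall i, `|'D_(delta_mx 0 i) f z - 'D_(delta_mx 0 i) f x| <= e.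
Proof.
move=> oU fC Ux e0.
suff /nbhs_ballP[r r0 H] : \forall z \near x,
    U z /\ forall i, `|'D_(delta_mx 0 i) f z - 'D_(delta_mx 0 i) f x| <= e.
  by exists r => // z /H.
near=> z; split; first by near: z; exact: open_nbhs_nbhs.
near: z; apply: filter_forall => i.
have [/cvgrPdist_le /(_ _ e0) + _] := fC [:: i] x isT Ux.
by apply: filterS => z /=; rewrite distrC.
Unshelve. all: by end_near. Qed.

Lemma derive_coord f z v j : derivable f z v ->
  is_derive z v (fun x => f x 0 j) ('D_v f z 0 j).
Proof.
move=> df; apply: DeriveDef; first by move/derivable_mxP : df; exact.
by rewrite derive_mx// mxE.
Qed.

(** In a small ball all partial derivatives are within [e'] of their values at
    [x], so [mean_value_box] bounds the error of the linear approximation by [e']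
    times the sum of the absolute coordinates of the increment. *)
Lemma class_C1_differentiable U f x :
  open U -> class_C 1 U f -> U x -> differentiable f x.
Proof.
move=> oU fC Ux.
pose J : 'M[R]_(m, n) := \matrix_(i, j) 'D_(delta_mx 0 i) f x 0 j.
pose df : {linear 'rV[R]_m -> 'rV[R]_n} := mulmxr J.
have dfc : continuous df.
  apply/linear_bounded_continuous/linear_boundedP; near=> r => h.
  apply: norm_le_coord => [|j]; first by rewrite mulr_ge0.
  rewrite mxE; apply: (le_trans (ler_norm_sum _ _ _)).
  apply: (@le_trans _ _ (\sum_i `|h| * `|J|)).
    apply: ler_sum => i _; rewrite normrM; apply: ler_pM => //.
      exact: coord_le_norm.
    rewrite [leRHS]/Num.Def.normr/= mx_normrE.
    exact: (le_bigmax _ (fun ij => `|J ij.1 ij.2|) (i, j)).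
  rewrite sumr_const card_ord -mulrnAr mulrC ler_wpM2r//.
have := @diff_unique R _ _ f df x; set dfo := (X in _ -> X -> _) => dfE.
suff o1 : dfo by apply/diff_locallyP; rewrite (dfE dfc o1).
apply/eqaddoP => e e0.
(* [m.+1] rather than [m], to allow for dimension 0. *)
pose e' := e / m.+1%:R.
have e'0 : 0 < e' by rewrite divr_gt0.
have [r r0 H] := partials_near oU fC Ux e'0.
apply/(@nbhs_ballP R 'rV[R]_m 0); exists r => //= h hr.
have hx : ball x r (h + x).
  move: hr.
  by rewrite -!ball_normE /= sub0r opprD addrCA subrr addr0.
rewrite /=; apply: norm_le_coord => [|j]; first by rewrite mulr_ge0 // ltW.
have := @mean_value_box R m (fun z => f z 0 j) x (h + x)
  (\row_i 'D_(delta_mx 0 i) f x 0 j) e'.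
have -> : \sum_i (\row_i 'D_(delta_mx 0 i) f x 0 j) 0 i * ((h + x) 0 i - x 0 i)
    = \sum_i h 0 i * J i j.
  by apply: eq_bigr => i _; rewrite !mxE addrK mulrC.
move=> HH; rewrite !mxE.
have L : `|f (h + x) 0 j - f x 0 j - \sum_i h 0 i * J i j|
    <= e' * \sum_i `|(h + x) 0 i - x 0 i|.
  apply: HH => z bz i.
  have [Uz Dz] : U z /\ forall i, `|'D_(delta_mx 0 i) f z - 'D_(delta_mx 0 i) f x| <= e'.
    by apply: H; apply: box_ball bz => //; exact: ballxx.
  have D := derive_coord j (class_C1_derivable (i := i) fC Uz).
  split; first by have [] := D.
  rewrite derive_val mxE.
  by have := le_trans (coord_le_norm _ j) (Dz i); rewrite !mxE.
rewrite opprD addrA; apply: (le_trans L).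
under eq_bigr do rewrite mxE addrK.
apply: (@le_trans _ _ (e' * (m%:R * `|h|))).
  by rewrite ler_wpM2l ?(ltW e'0)//; exact: sum_coord_le_norm.
rewrite mulrA ler_wpM2r// /e' mulrAC -mulrA ler_piMr ?(ltW e0)//.
by rewrite ler_pdivrMr// mul1r ler_nat.
Unshelve. all: by end_near. Qed.

Lemma class_C1_lipschitz_near U f x : open U -> class_C 1 U f -> U x ->
  exists r C : R, [/\ 0 < r, 0 <= C, ball x r `<=` U,
    forall z i, ball x r z -> `|'D_(delta_mx 0 i) f z| <= C &
    forall y z, ball x r y -> ball x r z -> `|f y - f z| <= C * m%:R * `|y - z| ].
Proof.
move=> oU fC Ux; have [r r0 H] := partials_near oU fC Ux ltr01.
pose C := \sum_(i < m) `|'D_(delta_mx 0 i) f x| + 1.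
have C0 : 0 <= C by rewrite addr_ge0// sumr_ge0.
have HC z i : ball x r z -> `|'D_(delta_mx 0 i) f z| <= C.
  move=> /H[_ /(_ i) Dz]; rewrite -(subrK ('D_(delta_mx 0 i) f x) ('D_ _ f z)).
  rewrite (le_trans (ler_normD _ _))// addrC lerD//.
  by rewrite (bigD1 i)//= lerDl sumr_ge0.
exists r, C; split => // [z /H[]//|y z By Bz].
apply: norm_le_coord => [|j]; first by rewrite !mulr_ge0.
rewrite !mxE.
have := @mean_value_box R m (fun z => f z 0 j) z y 0 C.
under eq_bigr do rewrite mxE mul0r.
rewrite big1// subr0 => HH; apply: le_trans (HH _) _ => [w bw i|].
  have Bw := box_ball Bz By bw; have [Uw _] := H _ Bw.
  have D := derive_coord j (class_C1_derivable (i := i) fC Uw).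
  split; first by have [] := D.
  by rewrite derive_val mxE subr0 (le_trans (coord_le_norm _ j))// HC.
rewrite -mulrA ler_wpM2l//.
by have := sum_coord_le_norm (y - z); under eq_bigr do rewrite !mxE.
Qed.

End class_C1.

(** * From local to global estimates on compact sets *)
Section local_to_global.
Context {R : realType} {V : normedModType R}.

(** Near [a] the local bound applies to pairs of close points; when [y] is not
    close to [x], [|x - y|] is bounded below and the crude bound [B] suffices. *)
Lemma compact_power_bound (K : set V) (q : V -> V -> R) (B : R) (k : nat) :
  compact K -> (forall x y, K x -> K y -> q x y <= B) ->
  (forall a, K a -> exists r C : R, 0 < r /\
     forall x y, K x -> K y -> ball a r x -> ball a r y -> q x y <= C * `|x - y| ^+ k) ->
  exists2 C, 0 < C & forall x y, K x -> K y -> q x y <= C * `|x - y| ^+ k.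
Proof.
move=> /compact_near_coveringP/near_covering_withinP cK qB loc.
suff : \forall C \near +oo, K `<=` [set x | forall y, K y -> q x y <= C * `|x - y| ^+ k].
  by move=> /pinfty_ex_gt0[C C0 HC]; exists C => // x y /HC; exact.
apply: cK => a Ka; have [r [C [r0 HC]]] := loc a Ka.
near=> x D => /= Kx y Ky.
have xa : ball a (r / 2) x by near: x; apply: near_ball; rewrite divr_gt0.
have [ya|ya] := pselect (ball a r y).
  apply: le_trans (HC _ _ Kx Ky _ ya) _.
    by apply: le_ball xa; rewrite ler_pdivrMr// ler_peMr ?ler1n// ltW.
  by rewrite ler_wpM2r ?exprn_ge0.
have rxy : r / 2 <= `|x - y|.
  rewrite leNgt; apply/negP => xy; apply: ya.
  rewrite (splitr r); apply: ball_triangle xa _.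
  by rewrite -ball_normE.
have rk : 0 < (r / 2) ^+ k by rewrite exprn_gt0// divr_gt0.
apply: (le_trans (qB _ _ Kx Ky)).
apply: (@le_trans _ _ (D * (r / 2) ^+ k)).
  by rewrite -ler_pdivrMr.
(* [D] ranges over a neighborhood of infinity. *)
have D0 : 0 <= D by [].
have r20 : 0 <= r / 2 by rewrite divr_ge0// ltW.
by rewrite ler_wpM2l// lerXn2r// nnegrE.
Unshelve. all: by end_near. Qed.

End local_to_global.

(** * The Hermitian product in real coordinates *)
Section hermitian.
Context {R : realType} {n : nat}.
Implicit Types (z w : 'rV[R]_(n + n)).

Definition dotr N (x c : 'rV[R]_N) : R := \sum_k x 0 k * c 0 k.

Lemma dotrC N (x c : 'rV[R]_N) : dotr x c = dotr c x.
Proof. by apply: eq_bigr => k _; rewrite mulrC. Qed.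

Lemma dotrBl N (x y c : 'rV[R]_N) : dotr (x - y) c = dotr x c - dotr y c.
Proof. by rewrite -sumrB; apply: eq_bigr => k _; rewrite !mxE mulrBl. Qed.

Lemma dotrBr N (x c d : 'rV[R]_N) : dotr x (c - d) = dotr x c - dotr x d.
Proof. by rewrite dotrC dotrBl !(dotrC x). Qed.

Lemma dotrZl N a (x c : 'rV[R]_N) : dotr (a *: x) c = a * dotr x c.
Proof. by rewrite mulr_sumr; apply: eq_bigr => k _; rewrite !mxE mulrA. Qed.

Lemma dotrZr N a (x c : 'rV[R]_N) : dotr x (a *: c) = a * dotr x c.
Proof. by rewrite dotrC dotrZl dotrC. Qed.

Lemma dotr_ge0 N (x : 'rV[R]_N) : 0 <= dotr x x.
Proof. by apply: sumr_ge0 => k _; rewrite -expr2 sqr_ge0. Qed.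

Lemma dotr_le N (x c : 'rV[R]_N) : `|dotr x c| <= N%:R * (`|x| * `|c|).
Proof.
apply: (le_trans (ler_norm_sum _ _ _)).
apply: (@le_trans _ _ (\sum_(i < N) `|x| * `|c|)).
  by apply: ler_sum => i _; rewrite normrM ler_pM// coord_le_norm.
by rewrite sumr_const card_ord mulr_natl.
Qed.

Lemma norm_le_dotr N (x : 'rV[R]_N) : `|x| ^+ 2 <= dotr x x.
Proof.
rewrite -[leRHS]sqr_sqrtr ?dotr_ge0// lerXn2r ?nnegrE ?sqrtr_ge0//.
apply: norm_le_coord => [|i]; first exact: sqrtr_ge0.
rewrite -sqrtr_sqr ler_wsqrtr// /dotr (bigD1 i)//= -expr2 lerDl.
by apply: sumr_ge0 => k _; rewrite -expr2 sqr_ge0.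
Qed.

(** Multiplication by the imaginary unit, read through [toC]. *)
Definition mulI z : 'rV[R]_(n + n) := row_mx (- rsubmx z) (lsubmx z).

Lemma mulIB z w : mulI (z - w) = mulI z - mulI w.
Proof. by rewrite /mulI !linearB opp_row_mx add_row_mx. Qed.

Lemma mulI_norm z : `|mulI z| <= `|z|.
Proof.
apply: norm_le_coord => // i; rewrite /mulI mxE.
by case: (fintype.split i) => j; rewrite !mxE ?normrN; exact: coord_le_norm.
Qed.

Lemma dotr_mulI z w : dotr (mulI z) (mulI w) = dotr z w.
Proof.
rewrite /dotr !big_split_ord /= addrC; congr (_ + _); apply: eq_bigr => i _.
  by rewrite !row_mxEr !mxE.
by rewrite !row_mxEl !mxE mulrNN.
Qed.

Lemma dotr_mulIx z : dotr z (mulI z) = 0.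
Proof.
rewrite /dotr big_split_ord /= -big_split big1//= => i _.
by rewrite row_mxEl row_mxEr !mxE mulrN mulrC addNr.
Qed.

Lemma hdotE z w : hdot (toC z) (toC w) = Complex (dotr z w) (dotr z (mulI w)).
Proof.
rewrite /hdot /dotr !big_split_ord /= -!big_split /=.
elim/big_ind3: _ => [|x a b y c d -> ->|i _]; [by []|by []|].
rewrite row_mxEl row_mxEr !mxE.
by congr Complex; ring.
Qed.

Lemma sphereE z : sphere R n z <-> dotr z z = 1.
Proof.
rewrite /sphere /hnorm /= hdotE dotr_mulIx; split => [|->]; last exact: sqrtC1.
by move/(congr1 (fun x => x ^+ 2)); rewrite sqrtCK expr1n => -[].
Qed.

(** The square of the anisotropic distance, at which the Riesz kernel is
    evaluated. *)
Definition gap z w : R := Normc.normc (1 - hdot (toC z) (toC w)).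

Lemma gapE z w : gap z w = Num.sqrt ((1 - dotr z w) ^+ 2 + dotr z (mulI w) ^+ 2).
Proof. by rewrite /gap hdotE /= sub0r sqrrN. Qed.

Lemma gap_ge0 z w : 0 <= gap z w.
Proof. by rewrite gapE sqrtr_ge0. Qed.

Lemma gap_le z w : gap z w <= `|1 - dotr z w| + `|dotr z (mulI w)|.
Proof.
rewrite gapE -[leRHS]ger0_norm ?addr_ge0// -sqrtr_sqr ler_wsqrtr//.
rewrite [leRHS]sqrrD -!normrX !(ger0_norm (sqr_ge0 _)) -addrA lerD2l lerDr mulrn_wge0// mulr_ge0//.
Qed.

(** On the sphere the real part of [1 - <z, w>] is half of the squared Euclidean
    distance, which dominates the squared sup norm. *)
Lemma gap_ge z w : sphere R n z -> sphere R n w -> `|z - w| ^+ 2 <= 2 * gap z w.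
Proof.
move=> /sphereE z1 /sphereE w1; apply: (le_trans (norm_le_dotr _)).
have -> : dotr (z - w) (z - w) = 2 * (1 - dotr z w).
  by rewrite !dotrBl !dotrBr z1 w1 (dotrC w z); ring.
rewrite ler_pM2l// (le_trans (ler_norm _))// gapE -sqrtr_sqr ler_wsqrtr//.
by rewrite lerDl sqr_ge0.
Qed.

(** As 2 is at most [expR 1], this makes the logarithmic kernel nonnegative on
    the sphere. *)
Lemma gap_le2 z w : sphere R n z -> sphere R n w -> gap z w <= 2.
Proof.
move=> /sphereE z1 /sphereE w1.
pose a := dotr z w; pose b := dotr z (mulI w).
have ab : a ^+ 2 + b ^+ 2 <= 1.
  (* Bessel inequality for the orthonormal vectors [w] and [mulI w]. *)
  have := dotr_ge0 (z - a *: w - b *: mulI w).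
  rewrite !(dotrBl, dotrBr, dotrZl, dotrZr) dotr_mulI !(dotrC _ z) z1 w1.
  rewrite (dotrC (mulI w)) dotr_mulIx -/a -/b; nra.
rewrite gapE -/a -/b -[leRHS]ger0_norm// -sqrtr_sqr ler_wsqrtr//; nra.
Qed.

End hermitian.

(** * Complex tangential maps *)
Section tangential.
Context {R : realType} {m n : nat}.
Implicit Types (Phi : 'rV[R]_m -> 'rV[R]_(n + n)) (W : set 'rV[R]_m).

(** Since [Phi] is differentiable, the columns of its complex Jacobian are its
    partial derivatives; apply the tangency condition to the basis vectors. *)
Lemma tangential_dotr W Phi x i : complex_tangential W Phi -> W x ->
  dotr ('D_(delta_mx 0 i) Phi x) (Phi x) = 0 /\
  dotr ('D_(delta_mx 0 i) Phi x) (mulI (Phi x)) = 0.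
Proof.
move=> [oW _ PhiC tan] Wx; have := tan x (delta_mx i 0) Wx.
rewrite map_delta_mx -colE.
have -> : col i (cjacobian Phi x) = toC ('D_(delta_mx 0 i) Phi x).
  rewrite (deriveEjacobian _ (class_C1_differentiable oW PhiC Wx)) -rowE.
  by apply/colP => j; rewrite !mxE.
by rewrite hdotE => -[].
Qed.

(** Tangency lets [T (Phi z)] be subtracted from [T (Phi y)] in the partial
    derivatives of [u |-> dotr (Phi u) (T (Phi y))]; what remains is of the order
    of [|y - z|], hence the quadratic bound.  It is used with the identity and
    with [mulI], for the real and imaginary parts of the Hermitian product. *)
Lemma dotr_image_near W Phi (T : 'rV[R]_(n + n) -> 'rV[R]_(n + n)) a :
  open W -> class_C 1 W Phi -> {morph T : u v / u - v} ->
  (forall u, `|T u| <= `|u|) ->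
  (forall x i, W x -> dotr ('D_(delta_mx 0 i) Phi x) (T (Phi x)) = 0) ->
  W a ->
  exists r C : R, 0 < r /\ forall x y, ball a r x -> ball a r y ->
    `|dotr (Phi x) (T (Phi y)) - dotr (Phi y) (T (Phi y))| <= C * `|x - y| ^+ 2.
Proof.
move=> oW PhiC TB Tn tan Wa.
have [r [C [r0 C0 BW DC L]]] := class_C1_lipschitz_near oW PhiC Wa.
pose A := (n + n)%:R * (C * (C * m%:R)).
exists r, (A * m%:R); split=> // x y Bx By.
pose w := T (Phi y).
have dw z i : W z -> is_derive z (delta_mx 0 i) (fun u => dotr (Phi u) w)
    (dotr ('D_(delta_mx 0 i) Phi z) w).
  move=> Wz; rewrite /dotr.
  have -> : (fun u => \sum_k Phi u 0 k * w 0 k) = \sum_k (w 0 k \*: (fun u => Phi u 0 k)).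
    by apply/funext => u; rewrite fct_sumE; apply: eq_bigr => k _; rewrite mulrC.
  have := derive_coord _ (class_C1_derivable (i := i) PhiC Wz) => D.
  apply: is_derive_eq; apply: eq_bigr => k _.
  by rewrite mulrC.
have := @mean_value_box R m (fun u => dotr (Phi u) w) y x 0 (A * `|x - y|).
under eq_bigr do rewrite mxE mul0r.
rewrite big1// subr0 => HH; apply: le_trans (HH _) _ => [z bz i|].
  have Bz := box_ball By Bx bz; have Wz := BW _ Bz.
  have D := dw z i Wz; split; first by have [] := D.
  rewrite derive_val mxE subr0 -[dotr _ w]subr0 -(tan z i Wz) -dotrBr /w -TB.
  apply: (le_trans (dotr_le _ _)); rewrite /A -!mulrA ler_wpM2l//.
  apply: ler_pM => //; first exact: DC.
  apply: (le_trans (Tn _)); apply: (le_trans (L _ _ By Bz)).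
  by rewrite -mulrA !ler_wpM2l// [leRHS]distrC box_dist.
rewrite expr2 -!mulrA !ler_wpM2l//.
rewrite mulrCA ler_wpM2l//.
by have := sum_coord_le_norm (x - y); under eq_bigr do rewrite !mxE.
Qed.

Lemma tangential_gap_near W Phi a : complex_tangential W Phi -> W a ->
  exists r C : R, 0 < r /\ forall x y, W x -> W y -> ball a r x -> ball a r y ->
    gap (Phi x) (Phi y) <= C * `|x - y| ^+ 2.
Proof.
move=> tanPhi Wa; have [oW sPhi PhiC _] := tanPhi.
have [|||r1 [C1 [r10 H1]]] := @dotr_image_near W Phi id a oW PhiC _ _ _ Wa => //.
  by move=> x i Wx; have [] := tangential_dotr i tanPhi Wx.
have [|||r2 [C2 [r20 H2]]] := @dotr_image_near W Phi mulI a oW PhiC _ _ _ Wa => //.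
- exact: mulIB.
- exact: mulI_norm.
- by move=> x i Wx; have [] := tangential_dotr i tanPhi Wx.
exists (Num.min r1 r2), (C1 + C2); split=> [|x y Wx Wy Bx By].
  by rewrite lt_min r10.
have B1 z : ball a (Num.min r1 r2) z -> ball a r1 z.
  by apply: le_ball; rewrite ge_min lexx.
have B2 z : ball a (Num.min r1 r2) z -> ball a r2 z.
  by apply: le_ball; rewrite ge_min lexx orbT.
have := H1 x y (B1 _ Bx) (B1 _ By); have := H2 x y (B2 _ Bx) (B2 _ By).
rewrite dotr_mulIx subr0 (sphereE _).1; last exact: sPhi.
move=> h2 h1; apply: (le_trans (gap_le _ _)).
by rewrite mulrDl lerD// distrC.
Qed.

Lemma tangential_gap_compact W Phi A : complex_tangential W Phi ->
  compact A -> A `<=` W ->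
  exists2 C, 0 < C & forall x y, A x -> A y ->
    gap (Phi x) (Phi y) <= C * `|x - y| ^+ 2.
Proof.
move=> tanPhi cA AW; have [_ sPhi _ _] := tanPhi.
apply: (@compact_power_bound _ _ _ (fun x y => gap (Phi x) (Phi y)) 2) => //.
  by move=> x y /AW/sPhi ? /AW/sPhi ?; exact: gap_le2.
move=> a /AW /(tangential_gap_near tanPhi)[r [C [r0 H]]].
by exists r, C; split=> // x y /AW Wx /AW Wy; exact: H.
Qed.

End tangential.

(** * Smooth maps on subsets *)
Section smooth.
Context {R : realType} {m n : nat}.

Lemma smooth_on_lipschitz (M K : set 'rV[R]_m) (g : 'rV[R]_m -> 'rV[R]_n) (B : R) :
  smooth_on M g -> compact K -> K `<=` M ->
  (forall x, K x -> `|g x| <= B) ->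
  exists2 C, 0 < C & forall x y, K x -> K y -> `|g x - g y| <= C * `|x - y|.
Proof.
move=> gM cK KM gB.
apply: (@compact_power_bound _ _ _ (fun x y => `|g x - g y|) (B + B) 1) => //.
  move=> x y Kx Ky; apply: (le_trans (ler_normB _ _)).
  by rewrite lerD// gB.
move=> a Ka; have [U [h [oU Ua hC gh]]] := gM a (KM _ Ka).
have [r [C [r0 C0 BU _ L]]] := class_C1_lipschitz_near oU (hC 1%N) Ua.
exists r, (C * m%:R); split=> // x y Kx Ky Bx By.
by rewrite !gh; [exact: L|exact: KM|exact: BU|exact: KM|exact: BU].
Qed.

Lemma lipschitz_continuous (K : set 'rV[R]_m) (g : 'rV[R]_m -> 'rV[R]_n) (C : R) :
  (forall x y, K x -> K y -> `|g x - g y| <= C * `|x - y|) ->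
  {within K, continuous g}.
Proof.
move=> L; apply/subspace_continuousP => x Kx; apply/cvgrPdist_le => e e0.
have C0 : 0 < `|C| + 1 by rewrite ltr_wpDl.
have : \forall y \near x, `|x - y| < e / (`|C| + 1).
  by apply/nbhs_normP; exists (e / (`|C| + 1)) => //=; rewrite divr_gt0.
apply: filterS => y; rewrite ltr_pdivlMr// => xy Ky.
apply: (le_trans (L _ _ Kx Ky)); apply: le_trans (ltW xy).
rewrite mulrC ler_wpM2l// (le_trans (ler_norm _))// lerDl//.
Qed.

End smooth.

(** * The Riesz kernel *)
Section kernel.
Context {R : realType}.
Local Open Scope ereal_scope.

Lemma riesz_kernel_ge0 n (alpha t : R) : (0 <= t <= 2)%R -> 0 <= riesz_kernel n alpha t.
Proof.
move=> /andP[t0 t2]; rewrite /riesz_kernel; case: ifPn => // tn0.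
have tgt0 : (0 < t)%R by rewrite lt_neqAle eq_sym tn0.
case: ifPn => _; rewrite lee_fin ?powR_ge0// ln_ge0//.
rewrite ler_pdivlMr// mul1r (le_trans t2)//.
by have := @expR_ge1Dx R 1.
Qed.

(** Since the kernel decreases, it is enough to evaluate it at [t / D]: there a
    power of [t] is multiplied by a constant and the logarithm is shifted by
    [ln D].  If [s = 0] then [t = 0] and the right-hand side is infinite. *)
Lemma riesz_kernel_scale n (alpha D : R) : (0 < D)%R ->
  exists C C' : R, [/\ (0 < C)%R, (0 <= C')%R & forall s t, (0 <= s)%R -> (0 <= t)%R ->
    (t <= D * s)%R ->
    riesz_kernel n alpha s <= C%:E * riesz_kernel n alpha t + C'%:E].
Proof.
move=> D0; exists (if (alpha < n%:R)%R then ((D^-1) `^ (alpha - n%:R))%R else 1%R), `|ln D|%R.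
split=> //; first by case: ifP => // _; rewrite powR_gt0 ?invr_gt0.
move=> s t s0 t0 tDs; rewrite /riesz_kernel.
have [_|tn0] := eqVneq t 0%R.
  rewrite gt0_muley ?addye ?leey//; case: ifP => // _.
  by rewrite lte_fin powR_gt0 ?invr_gt0.
have tgt0 : (0 < t)%R by rewrite lt_neqAle eq_sym tn0.
have sgt0 : (0 < s)%R.
  rewrite lt_neqAle s0 andbT eq_sym; apply/eqP => s00.
  by move: tDs; rewrite s00 mulr0 leNgt tgt0.
rewrite gt_eqF//.
have tDs' : (D^-1 * t <= s)%R by rewrite ler_pdivrMl.
case: ifPn => an.
  rewrite -EFinM -EFinD lee_fin -powRM ?invr_ge0 ?(ltW D0)//.
  rewrite (le_trans (_ : _ <= (D^-1 * t) `^ (alpha - n%:R))%R)// ?lerDl//.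
  rewrite -(opprB n%:R alpha) !powRN lef_pV2 ?posrE ?powR_gt0 ?mulr_gt0 ?invr_gt0//.
  by rewrite ge0_ler_powR ?nnegrE ?mulr_ge0 ?invr_ge0 ?(ltW D0)// subr_ge0 ltW.
rewrite mul1e -EFinD lee_fin.
have e0 := @expR_gt0 R 1.
apply: (le_trans _ (lerD (lexx _) (ler_norm _))).
rewrite -lnM ?posrE ?divr_gt0// ler_ln ?posrE ?mulr_gt0 ?invr_gt0//.
rewrite -mulrA ler_pM2l// mulrC ler_pdivlMr// mulrC ler_pdivrMr//.
Qed.

Lemma measurable_riesz_kernel n (alpha : R) :
  measurable_fun [set: R] (riesz_kernel n alpha).
Proof.
apply: measurable_fun_if => //.
- by apply: measurable_fun_eqr => //.
- rewrite setTI; case: (alpha < n%:R)%R.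
    apply/measurable_EFinP; apply: measurable_funTS.
    exact: measurable_powR.
  apply/measurable_EFinP; apply: measurableT_comp; first exact: measurable_ln.
  apply: measurable_funM => //.
  (* The quotient is continuous off 0, where the first branch takes over. *)
  rewrite [X in measurable_fun X _](_ : _ = [set t | t != 0%R]); last first.
    by apply/seteqP; split => t /= => [->|/negbTE].
  apply: open_continuous_measurable_fun; first exact: open_neq.
  by move=> t; rewrite inE /= => t0; exact: inv_continuous.
Qed.

End kernel.

(** * Borel measurability *)
Section borel.
Context {R : realType} {n : nat}.
Local Notation T := (borelC R n).

Lemma open_borelC (A : set 'rV[R]_(n + n)) : open A -> measurable (A : set T).
Proof. by move=> oA; exact: sub_sigma_algebra. Qed.

Lemma compact_borelC (K : set 'rV[R]_(n + n)) : compact K -> measurable (K : set T).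
Proof.
move=> cK; rewrite -(setCK K); apply: measurableC; apply: open_borelC.
by rewrite openC; apply: compact_closed => //; exact: norm_hausdorff.
Qed.

Lemma measurable_coord i : measurable_fun setT (fun x : T => (x : 'rV[R]_(n + n)) 0 i).
Proof.
apply: (measurability _ (RGenOInfty.measurableE R)) => /= _ [_ [a ->] <-].
rewrite setTI; apply: open_borelC.
apply: (open_comp (f := fun x : 'rV[R]_(n + n) => x 0 i)); last exact: rray_open.
by move=> x _; exact: coord_continuous.
Qed.

Lemma measurable_dotr d (X : measurableType d) (f g : X -> 'rV[R]_(n + n)) :
  (forall i, measurable_fun setT (fun x => f x 0 i)) ->
  (forall i, measurable_fun setT (fun x => g x 0 i)) ->
  measurable_fun setT (fun x => dotr (f x) (g x)).
Proof.
by move=> mf mg; apply: measurable_sum => i; exact: measurable_funM.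
Qed.

Lemma measurable_sphere : measurable (sphere R n : set T).
Proof.
have -> : (sphere R n : set T) = (fun x : T => dotr (x : 'rV[R]_(n + n)) x) @^-1` [set 1].
  by apply/seteqP; split => x /=; rewrite sphereE.
rewrite -[X in measurable X]setTI.
have : measurable_fun setT (fun x : T => dotr (x : 'rV[R]_(n + n)) x).
  by apply: measurable_dotr => i; exact: measurable_coord.
by apply => //; exact: measurable_set1.
Qed.

Lemma measurable_gap : measurable_fun setT
  (fun p : T * T => gap (p.1 : 'rV[R]_(n + n)) (p.2 : 'rV[R]_(n + n))).
Proof.
have m1 i : measurable_fun setT (fun p : T * T => (p.1 : 'rV[R]_(n + n)) 0 i).
  by apply: (measurableT_comp (measurable_coord i)); exact: measurable_fst.
have m2 i : measurable_fun setT (fun p : T * T => (p.2 : 'rV[R]_(n + n)) 0 i).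
  by apply: (measurableT_comp (measurable_coord i)); exact: measurable_snd.
have m3 i : measurable_fun setT
    (fun p : T * T => mulI (p.2 : 'rV[R]_(n + n)) 0 i).
  have -> : (fun p : T * T => mulI (p.2 : 'rV[R]_(n + n)) 0 i) =
      match fintype.split i with
      | inl j => fun p => - (p.2 : 'rV[R]_(n + n)) 0 (rshift n j)
      | inr j => fun p => (p.2 : 'rV[R]_(n + n)) 0 (lshift n j)
      end.
    by apply/funext => p; rewrite /mulI mxE; case: (fintype.split i) => j; rewrite !mxE.
  by case: (fintype.split i) => j; [exact: measurableT_comp|exact: m2].
under [X in measurable_fun _ X]eq_fun do rewrite gapE.
apply: measurableT_comp.
  by apply: continuous_measurable_fun; exact: sqrt_continuous.
apply: measurable_funD; apply: measurable_funX.
  by apply: measurable_funB => //; exact: measurable_dotr.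
exact: measurable_dotr.
Qed.

(** Gives a transport map that is Borel on the whole space, although continuity
    is only available on [K]. *)
Lemma measurable_patch_continuous (K : set 'rV[R]_(n + n))
    (F : 'rV[R]_(n + n) -> 'rV[R]_(n + n)) : compact K -> {within K, continuous F} ->
  measurable_fun setT (patch (fun=> 0) K F : T -> T).
Proof.
move=> cK cF.
apply: (@measurability _ _ T T setT _ (@open 'rV[R]_(n + n)) erefl) => _ [A oA <-].
have oFA := (continuousP (F : subspace K -> 'rV[R]_(n + n))).1 cF A oA.
have [V oV VK] := (@open_subspaceP 'rV[R]_(n + n) K (F @^-1` A)).1 oFA.
rewrite setTI (_ : _ @^-1` A = (V `&` K) `|` (~` K `&` [set _ | A 0])); last first.
  rewrite VK; apply/seteqP; split=> x; rewrite /patch /=.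
    case: ifPn => [/set_mem Kx|/negP xK] Ax; first by left.
    by right; split=> // Kx; apply: xK; rewrite inE.
  case=> [[Fx Kx]|[Kx A0]]; first by rewrite mem_set.
  by rewrite memNset.
apply: measurableU.
  by apply: measurableI; [exact: open_borelC|exact: compact_borelC].
apply: measurableI; first by apply: measurableC; exact: compact_borelC.
have [A0|A0] := pselect (A 0).
  by rewrite (_ : [set _ | _] = setT)//; apply/seteqP; split.
by rewrite (_ : [set _ | _] = set0)//; apply/seteqP; split.
Qed.

End borel.

(** * Energy, capacity and transport of measures *)
Section capacity.
Context {R : realType} {n : nat}.
Implicit Types (alpha : R) (E K M : set 'rV[R]_(n + n)).
Local Notation T := (borelC R n).
Local Open Scope ereal_scope.

Let kernel alpha (p : T * T) := riesz_kernel n alpha (gap p.1 p.2).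

Let sphere2 : set (T * T) := sphere R n `*` sphere R n.

Let measurable_sphere2 : measurable sphere2.
Proof. by apply: measurableX; exact: measurable_sphere. Qed.

Let measurable_kernel alpha D : measurable_fun D (kernel alpha).
Proof.
apply: measurable_funTS; apply: (measurableT_comp (measurable_riesz_kernel n alpha)).
exact: measurable_gap.
Qed.

Let kernel_ge0 alpha p : sphere2 p -> 0 <= kernel alpha p.
Proof.
by move=> [p1 p2]; apply: riesz_kernel_ge0; rewrite gap_ge0/=; exact: gap_le2.
Qed.

Lemma riesz_energy_ge0 alpha (mu : probability T R) : 0 <= riesz_energy alpha mu.
Proof. by apply: integral_ge0 => p; exact: kernel_ge0. Qed.

Lemma cap_compact_gt0 alpha E : 0 < cap_compact alpha E <->
  exists2 mu : probability T R, mu (~` E) = 0 & riesz_energy alpha mu < +oo.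
Proof.
rewrite /cap_compact; set A := [set _ | _ in _].
have A0 : 0 <= ereal_inf A.
  by apply: le_ereal_inf_tmp => _ [mu _ <-]; exact: riesz_energy_ge0.
have -> : (0 < (ereal_inf A)^-1) = (ereal_inf A < +oo).
  by rewrite lt_neqAle inve_ge0 A0 andbT eq_sym inve_eq0 ltey.
split=> [/ereal_inf_lt[_ [mu muE <-]] muoo|[mu muE muoo]]; first by exists mu.
by apply: le_lt_trans muoo; apply: ereal_inf_lbound; exists mu.
Qed.

Lemma cap_gt0 alpha M : 0 < cap alpha M <-> exists K (mu : probability T R),
  [/\ compact K, K `<=` M, mu (~` K) = 0 & riesz_energy alpha mu < +oo].
Proof.
split=> [/ereal_sup_gt[_ [K [cK KM] <-]] /cap_compact_gt0[mu muK muoo]|].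
  by exists K, mu.
move=> [K [mu [cK KM muK muoo]]].
have : 0 < cap_compact alpha K by apply/cap_compact_gt0; exists mu.
by move=> /lt_le_trans; apply; apply: ereal_sup_ubound; exists K.
Qed.

(** The product of the image measures is the image of the product measure, so
    the energy of the image is the integral of the kernel at [(F x, F y)] against
    the product of [mu] with itself.  That product charges only [K `*` K], where
    [riesz_kernel_scale] bounds the integrand by an affine function of the kernel
    at [(x, y)]. *)
Lemma riesz_energy_transport alpha (mu : probability T R) K
    (F : 'rV[R]_(n + n) -> 'rV[R]_(n + n)) (D : R) :
  compact K -> K `<=` sphere R n -> (forall x, K x -> sphere R n (F x)) ->
  {within K, continuous F} -> (0 < D)%R ->
  (forall x y, K x -> K y -> (gap x y <= D * gap (F x) (F y))%R) ->
  mu (~` K) = 0 -> riesz_energy alpha mu < +oo ->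
  exists2 nu : probability T R, nu (~` (F @` K)) = 0 & riesz_energy alpha nu < +oo.
Proof.
move=> cK KS FS cF D0 gapF muK muoo.
have mK := compact_borelC cK.
have mF := measurable_patch_continuous cK cF.
pose F0 : T -> T := patch (fun=> 0%R) K F.
have F0E x : K x -> F0 x = F x by move=> Kx; rewrite /F0 /patch mem_set.
pose FT : {mfun T >-> T} := HB.pack F0 (isMeasurableFun.Build _ _ _ _ F0 mF).
exists (distribution mu FT).
  rewrite /distribution /pushforward; apply: (subset_measure0 _ _ _ muK).
  - rewrite -[X in measurable X]setTI; apply: (mF measurableT); apply: measurableC.
    by apply: compact_borelC; exact: continuous_compact.
  - exact: measurableC.
  - by move=> x /= Fx Kx; apply: Fx; exists x => //; rewrite F0E.
pose G (p : T * T) : T * T := (F0 p.1, F0 p.2).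
have mG : measurable_fun setT G.
  apply: measurable_fun_pair.
  - exact: (measurableT_comp mF measurable_fst).
  - exact: (measurableT_comp mF measurable_snd).
pose GT : {mfun (T * T)%type >-> (T * T)%type} :=
  HB.pack G (isMeasurableFun.Build _ _ _ _ G mG).
have nuE A : measurable A ->
    (distribution mu FT \x distribution mu FT) A = pushforward (mu \x mu) GT A.
  apply: product_measure_unique => B C mB mC.
  change ((mu \x mu) ((F0 @^-1` B) `*` (F0 @^-1` C)) = mu (F0 @^-1` B) * mu (F0 @^-1` C)).
  rewrite product_measure1E// -[X in measurable X]setTI; exact: (mF measurableT).
(* [Q], the complement of [K `*` K], is negligible. *)
pose Q := (~` K : set T) `*` setT `|` setT `*` (~` K : set T).
have mKC : measurable (~` K : set T) by exact: measurableC.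
have mQ : measurable Q by apply: measurableU; apply: measurableX.
have Q1 : (mu \x mu) ((~` K : set T) `*` setT) = 0.
  by rewrite product_measure1E// [X in X * _]muK mul0e.
have Q2 : (mu \x mu) (setT `*` (~` K : set T)) = 0.
  by rewrite product_measure1E// [X in _ * X]muK mule0.
have Q0 : (mu \x mu) Q = 0.
  by rewrite /Q measureU0//; exact: measurableX.
have QE p : ~ Q p -> K p.1 /\ K p.2.
  move=> nQ; split; apply: contrapT => nK; apply: nQ; by [left|right].
have [C [C' [C0 C'0 HC]]] := riesz_kernel_scale n alpha D0.
have kG p : ~ Q p -> kernel alpha (GT p) <= C%:E * kernel alpha p + C'%:E.
  move=> /QE[K1 K2]; rewrite /kernel /GT /= !F0E//.
  by apply: HC; [exact: gap_ge0|exact: gap_ge0|exact: gapF].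
have -> : riesz_energy alpha (distribution mu FT) =
    \int[pushforward (mu \x mu) GT]_(p in sphere2) kernel alpha p.
  by apply: eq_measure_integral => A mA _; exact: nuE.
have mGS : measurable (GT @^-1` sphere2).
  by rewrite -[X in measurable X]setTI; exact: (mG measurableT).
rewrite (ge0_integral_pushforward mG _ measurable_sphere2
  (@measurable_kernel alpha sphere2)); last first.
  by move=> p /set_mem; exact: kernel_ge0.
have mkG B : measurable_fun B (kernel alpha \o GT).
  apply: measurable_funTS; apply: measurableT_comp; last exact: mG.
  exact: measurable_kernel.
rewrite (ge0_negligible_integral mQ mGS (mkG _) _ Q0); last first.
  by move=> p; exact: kernel_ge0.
have mB B : measurable_fun B (fun p => C%:E * kernel alpha p + C'%:E).
  by apply: emeasurable_funD => //; apply: measurable_funeM.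
have bound_ge0 p : sphere2 p -> 0 <= C%:E * kernel alpha p + C'%:E.
  by move=> Sp; rewrite adde_ge0 ?lee_fin// mule_ge0 ?kernel_ge0 ?lee_fin// ltW.
have sub p : ~ Q p -> sphere2 p by move=> /QE[/KS ? /KS ?].
apply: (@le_lt_trans _ _
    (\int[mu \x mu]_(p in GT @^-1` sphere2 `\` Q) (C%:E * kernel alpha p + C'%:E))).
  apply: ge0_le_integral => //; first exact: measurableD.
  - by move=> p [Sp _]; exact: kernel_ge0.
  - by move=> p [_ nQ]; exact: kG.
apply: (@le_lt_trans _ _ (\int[mu \x mu]_(p in sphere2) (C%:E * kernel alpha p + C'%:E))).
  apply: ge0_subset_integral => //; first exact: measurableD.
  by move=> p [_ nQ]; exact: sub.
rewrite ge0_integralD//; last 2 first.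
- by move=> p Sp; rewrite mule_ge0 ?kernel_ge0 ?lee_fin// ltW.
- by apply: measurable_funeM.
rewrite ge0_integralZl//; last 2 first.
- by move=> p; exact: kernel_ge0.
- by rewrite lee_fin ltW.
apply: lte_add_pinfty.
  by apply: lte_mul_pinfty => //; rewrite lee_fin ltW.
have S2oo : (mu \x mu) sphere2 < +oo.
  have muS := probability_le1 mu measurable_sphere.
  rewrite /sphere2 product_measure1E; [|exact: measurable_sphere|exact: measurable_sphere].
  by apply: (@le_lt_trans _ _ (1 * 1)); [exact: lee_pmul|rewrite mule1 ltry].
by rewrite integral_cst//; apply: lte_mul_pinfty; rewrite ?lee_fin.
Qed.

End capacity.

(** * Comparison of two tangential charts *)
Section transfer.
Context {R : realType} {n m : nat}.

Lemma cube_norm_le (x : 'rV[R]_m) : cube R m x -> `|x| <= 1.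
Proof.
move=> cx; apply: norm_le_coord => // i; have /andP[h1 h2] := cx i.
by rewrite ler_norml !ltW.
Qed.

Lemma cap_gt0_transfer (M N : set 'rV[R]_(n + n))
    (Phi Psi : 'rV[R]_m -> 'rV[R]_(n + n)) (alpha : R) :
  nash_diffeo (cube R m) M Phi -> complex_tangential (cube R m) Phi ->
  nash_diffeo (cube R m) N Psi -> complex_tangential (cube R m) Psi ->
  (0 < cap alpha M -> 0 < cap alpha N)%E.
Proof.
move=> [g [_ [[_ _ gM _] gS] _ gK]] tanPhi [h [[[_ _ PsiN _] _] [[_ _ hN _] hS] PsiK _]] tanPsi.
move=> /cap_gt0[K [mu [cK KM muK muoo]]]; apply/cap_gt0.
have [_ sPhi _ _] := tanPhi; have [_ sPsi PsiC _] := tanPsi.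
have [Lg Lg0 gL] := smooth_on_lipschitz gS cK KM (fun x Kx => cube_norm_le (gM x (KM x Kx))).
have gcont := lipschitz_continuous gL.
pose A := g @` K.
have cA : compact A by exact: continuous_compact.
have AC : A `<=` cube R m by move=> _ [x Kx <-]; exact/gM/KM.
have PsicontA : {within A, continuous Psi}.
  apply: continuous_in_subspaceT => x; rewrite inE => /AC.
  exact: class_C1_continuous.
have cF : {within K, continuous (Psi \o g)}.
  apply/subspace_continuousP => x Kx; have /subspace_continuousP gx := gcont.
  apply: (cvg_comp _ _ (gx x Kx)).
  exact: (class_C1_continuous PsiC (gM _ (KM _ Kx))).
have cL : compact (Psi @` A) by exact: continuous_compact.
have LN : Psi @` A `<=` N by move=> _ [x /AC Ax <-]; exact: PsiN.
have [Lh Lh0 hL] := smooth_on_lipschitz hS cL LN (fun x Lx => cube_norm_le (hN x (LN x Lx))).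
have [C C0 HC] := tangential_gap_compact tanPhi cA AC.
(* gap x y <= C |g x - g y|^2 <= C Lh^2 |Psi (g x) - Psi (g y)|^2, and [gap_ge]
   costs a factor 2. *)
have gapK x y : K x -> K y -> gap x y <= (C * Lh ^+ 2 * 2) * gap (Psi (g x)) (Psi (g y)).
  move=> Kx Ky; have Ax : A (g x) by exists x.
  have Ay : A (g y) by exists y.
  have := HC _ _ Ax Ay; rewrite !gK; [|exact: KM|exact: KM].
  move=> /le_trans; apply; rewrite -!mulrA ler_pM2l//.
  have := hL (Psi (g x)) (Psi (g y)) (ex_intro2 _ _ _ Ax erefl) (ex_intro2 _ _ _ Ay erefl).
  rewrite !PsiK; [|exact: AC|exact: AC] => hxy.
  apply: (@le_trans _ _ ((Lh * `|Psi (g x) - Psi (g y)|) ^+ 2)).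
    by rewrite lerXn2r ?nnegrE// mulr_ge0// ltW.
  rewrite exprMn [Lh ^+ 2]expr2 -!mulrA !ler_pM2l//.
  by apply: gap_ge; apply: sPsi; exact: AC.
have [|||nu nuL nuoo] := riesz_energy_transport cK _ _ cF _ gapK muK muoo.
- by move=> x /KM Mx; rewrite -(gK _ Mx); apply/sPhi/gM.
- by move=> x /KM Mx; apply/sPsi/gM.
- by rewrite !mulr_gt0 ?exprn_gt0.
exists ((Psi \o g) @` K), nu; split => //.
  by exact: continuous_compact.
by move=> _ [x Kx <-]; apply: PsiN; apply/gM/KM.
Qed.

End transfer.

Theorem proposition2 (R : realType) (n m : nat) (M N : set 'rV[R]_(n + n))
    (alpha : R) :
  (2 <= n)%N -> (1 <= m <= n - 1)%N ->
  M `<=` sphere R n -> N `<=` sphere R n ->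
  nash_submanifold M -> nash_submanifold N ->
  (exists Phi : 'rV[R]_m -> 'rV[R]_(n + n),
     nash_diffeo (cube R m) M Phi /\ complex_tangential (cube R m) Phi) ->
  (exists Psi : 'rV[R]_m -> 'rV[R]_(n + n),
     nash_diffeo (cube R m) N Psi /\ complex_tangential (cube R m) Psi) ->
  0 < alpha <= n%:R ->
  (0 < cap alpha M)%E <-> (0 < cap alpha N)%E.
Proof.
move=> _ _ _ _ _ _ [Phi [dPhi tPhi]] [Psi [dPsi tPsi]] _.
by split; [exact: (cap_gt0_transfer dPhi tPhi dPsi tPsi)|
  exact: (cap_gt0_transfer dPsi tPsi dPhi tPhi)].
Qed.
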